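(* Let $p>p_1$, where $p_1\approx 1.46498$ is the unique solution in $(1,\infty)$ of $\zeta(p_1)=2^{p_1}$, and let $m\in\mathbb{R}$ satisfy $$m_p<m<\frac{1}{m_p},\qquad m_p:=\frac{2^{p}-\sqrt{4^{p}-\zeta(p)^2}}{\zeta(p)}.$$ Let $f_{12}(x)=m|x|^{-p}$, $f_{11}(x)=-|x|^{-p}$ and $f_{22}(x)=-m^2|x|^{-p}$ for $x\ne 0$, and $\mathcal{F}=(f_{11},f_{22},f_{12})$. Then the equidistant configuration is the unique minimizer of $E_{\mathcal{F}}$ at any scale, i.e. for every $\rho>0$ and every $N\in 2\mathbb{N}$, $e^{\rho}$ is the unique minimizer of $E_{\mathcal{F}}$ in $\mathcal{A}_N^{\rho}$.
   Context: $\zeta(s)=\sum_{n\ge1}n^{-s}$ is Riemann's zeta function. For $\rho>0$ and a positive even integer $N$ (written $N\in 2\mathbb{N}$), let $$\mathcal{A}_N^{\rho}=\{(x_k)_{k\in\mathbb{Z}}\subset\mathbb{R}:\ x_0=0,\ x_k<x_{k+1}\text{ and }x_{k+N}=x_k+\rho^{-1}N\ \text{ for all }k\in\mathbb{Z}\}$$ be the class of $N$-periodic configurations of density $\rho$. The particle $x_k$ is of type $\epsilon_k$, where $\epsilon_k=1$ if $k$ is odd and $\epsilon_k=2$ if $k$ is even. The equidistant configuration is $e^{\rho}:=(k\rho^{-1})_{k\in\mathbb{Z}}\in\mathcal{A}_N^{\rho}$. Given mirror symmetric interaction potentials $f_{11},f_{22},f_{12}$ (i.e. $f_{\alpha\beta}(-x)=f_{\alpha\beta}(x)$),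 with $f_{21}:=f_{12}$, and $\mathcal{F}=(f_{11},f_{22},f_{12})$, the energy of $X=(x_i)_{i\in\mathbb{Z}}\in\mathcal{A}_N^{\rho}$ is $$E_{\mathcal{F}}(X)=\frac1N\sum_{n=1}^{N}\ \sum_{k\in\mathbb{Z},\,k\neq n} f_{\epsilon_n\epsilon_k}(x_k-x_n).$$ *)

(* Defs.v *)
From Stdlib Require Import Reals ZArith.
From Coquelicot Require Import Coquelicot.

Open Scope R_scope.

(** Riemann's zeta function on real arguments; meaningful for [1 < s], where the
    series converges. *)
Definition zeta (s : R) : R := Series (fun n => Rpower (INR (S n)) (- s)).

Definition m_crit (p : R) : R :=
  (Rpower 2 p - sqrt (Rpower 4 p - zeta p ^ 2)) / zeta p.

(** Bilateral series as the sum of its two one-sided halves. [Series] is total,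
    with an unspecified value for a divergent series; for potentials bounded by
    a multiple of [|x|^-p] with [1 < p], all the series taken below converge
    absolutely. *)
Definition ZSeries (a : Z -> R) : R :=
  Series (fun j => a (Z.of_nat j)) + Series (fun j => a (- Z.of_nat (S j))%Z).

Inductive species : Set := type1 | type2.

Definition species_of (k : Z) : species := if Z.odd k then type1 else type2.

Record potentials : Type := Potentials {
  f11 : R -> R;
  f22 : R -> R;
  f12 : R -> R
}.

Definition interaction (F : potentials) (a b : species) : R -> R :=
  match a, b with
  | type1, type1 => f11 F
  | type2, type2 => f22 F
  | type1, type2 | type2, type1 => f12 F
  end.

Definition configuration (rho : R) (N : nat) (x : Z -> R) : Prop :=
  x 0%Z = 0 /\
  forall k : Z, x k < x (k + 1)%Z /\ x (k + Z.of_nat N)%Z = x k + / rho * INR N.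

Definition equidistant (rho : R) : Z -> R := fun k => IZR k * / rho.

Definition energy (F : potentials) (N : nat) (x : Z -> R) : R :=
  / INR N *
  sum_n_m (fun i : nat =>
    let n := Z.of_nat i in
    ZSeries (fun k =>
      if Z.eq_dec k n then 0
      else interaction F (species_of n) (species_of k) (x k - x n))) 1 N.

Definition minimizer {T : Type} (A : T -> Prop) (E : T -> R) (x : T) : Prop :=
  A x /\ forall y, A y -> E x <= E y.

(* Main.v *)
(** By periodicity the energy is [2/N] times the sum over [k >= 1] of the shells
    of pairs at index distance [k]. Let [A] be the sum of [gap^-p] over a period.
    For odd [k] the shell is repulsive and convexity of [x^-p] makes it minimal at
    the equidistant configuration; for [k = 1] it equals [m A]. For even [k] the
    shell is attractive, and Jensen's inequality applied to the [k] gaps of each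
    window bounds it below by [- (1 + m^2)/2 k^-p A], with equality at the
    equidistant configuration. Summing over [k], the energy excess is at least a
    positive multiple of [(m - (1 + m^2)/2 2^-p zeta(p)) (A - A_eq)]; the first
    factor is positive exactly for [m_p < m < 1/m_p], and [A >= A_eq] with
    equality only at the equidistant configuration. *)

Require Import Defs.
From Stdlib Require Import Reals ZArith Ranalysis5 Lra Lia FunctionalExtensionality.
From Coquelicot Require Import Coquelicot.

Open Scope R_scope.

(** * Powers and the tangent-line inequality for [x^-p] *)

Lemma Rpower_pos (x s : R) : 0 < Rpower x s.
Proof. apply exp_pos. Qed.

Lemma Rpower_1_l (s : R) : Rpower 1 s = 1.
Proof. unfold Rpower. now rewrite ln_1, Rmult_0_r, exp_0. Qed.

Lemma Rpower_scale (c x p : R) :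
  0 < c -> 0 < x -> Rpower (c * x) (- p) = Rpower c (- p) * Rpower x (- p).
Proof. intros; now rewrite Rpower_mult_distr. Qed.

Lemma INR_S_pos (n : nat) : 0 < INR (S n).
Proof. apply lt_0_INR; lia. Qed.

Lemma INR_S_ge_1 (n : nat) : 1 <= INR (S n).
Proof. rewrite S_INR. generalize (pos_INR n); lra. Qed.

(** Combines [exp v > 1 + v] at [v = - p ln u], strict because [ln u <> 0], with [ln u <= u - 1]. *)
Lemma Rpower_tangent_1 (p u : R) :
  0 < p -> 0 < u -> u <> 1 -> 1 - p * (u - 1) < Rpower u (- p).
Proof.
  intros Hp Hu Hu1.
  assert (Hl : ln u <> 0).
  { intro E. apply Hu1, ln_inv; [assumption | lra | now rewrite ln_1]. }
  generalize (exp_ineq1 (- p * ln u) ltac:(nra)) (exp_ineq1_le (ln u)).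
  rewrite exp_ln by assumption. unfold Rpower. nra.
Qed.

(** Homogeneity reduces a general base point [t] to the case 1 through [u = y / t]. Strictness is
    what later yields uniqueness. *)
Lemma Rpower_tangent_strict (p t y : R) :
  0 < p -> 0 < t -> 0 < y -> y <> t ->
  Rpower t (- p) - p * Rpower t (- p) / t * (y - t) < Rpower y (- p).
Proof.
  intros Hp Ht Hy Hne.
  assert (Hu : 0 < y / t) by now apply Rdiv_lt_0_compat.
  assert (Hu1 : y / t <> 1).
  { intro E. apply Hne. replace y with (y / t * t) by (field; lra). rewrite E; ring. }
  replace (Rpower y (- p)) with (Rpower t (- p) * Rpower (y / t) (- p))
    by (rewrite <- Rpower_scale by assumption; f_equal; field; lra).
  replace (Rpower t (- p) - p * Rpower t (- p) / t * (y - t))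
    with (Rpower t (- p) * (1 - p * (y / t - 1))) by (field; lra).
  apply Rmult_lt_compat_l; [apply Rpower_pos | now apply Rpower_tangent_1].
Qed.

Lemma Rpower_tangent (p t y : R) :
  0 < p -> 0 < t -> 0 < y ->
  Rpower t (- p) - p * Rpower t (- p) / t * (y - t) <= Rpower y (- p).
Proof.
  intros Hp Ht Hy. destruct (Req_dec y t) as [-> | Hne].
  - right. ring.
  - left. now apply Rpower_tangent_strict.
Qed.

(** * Comparison of series, and the zeta function *)

Lemma Series_nonneg (a : nat -> R) :
  (forall n, 0 <= a n) -> ex_series a -> 0 <= Series a.
Proof.
  intros Ha Hex.
  replace 0 with (Series (fun n => 0 * a n)) by (rewrite Series_scal_l; ring).
  apply Series_le; [| assumption]. intro n. specialize (Ha n). lra.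
Qed.

Lemma ex_series_scal_R (c : R) (a : nat -> R) :
  ex_series a -> ex_series (fun n => c * a n).
Proof. exact (ex_series_scal_l (V := R_NormedModule) c a). Qed.

Lemma ex_series_plus_R (a b : nat -> R) :
  ex_series a -> ex_series b -> ex_series (fun n => a n + b n).
Proof. exact (ex_series_plus (V := R_NormedModule) a b). Qed.

Lemma ex_series_minus_R (a b : nat -> R) :
  ex_series a -> ex_series b -> ex_series (fun n => a n - b n).
Proof. exact (ex_series_minus (V := R_NormedModule) a b). Qed.

Lemma ex_series_dominated (a b : nat -> R) :
  (forall n, Rabs (a n) <= b n) -> ex_series b -> ex_series a.
Proof. exact (ex_series_le (V := R_CompleteNormedModule) a b). Qed.

(** The terms may have either sign, as shell energies do; only the difference [b - a] has to be
    nonnegative. *)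
Lemma Series_le_minor (a b : nat -> R) :
  (forall n, a n <= b n) -> ex_series a -> ex_series b -> Series a <= Series b.
Proof.
  intros H Ha Hb.
  assert (0 <= Series (fun n => b n - a n)).
  { apply Series_nonneg; [intro n; specialize (H n); lra | now apply ex_series_minus_R]. }
  rewrite Series_minus in H0 by assumption. lra.
Qed.

(* Comparison with the telescoping sum of [n^(1-s) / (s-1)]. *)
Lemma zeta_partial_sum_le (s : R) (n : nat) :
  1 < s ->
  (s - 1) * sum_f_R0 (fun k => Rpower (INR (S k)) (- s)) n
    <= s - Rpower (INR (S n)) (- (s - 1)).
Proof.
  intros Hs. induction n as [|n IH].
  - simpl. rewrite !Rpower_1_l. lra.
  - rewrite tech5.
    (* The tangent of [x^-(s-1)] at [n + 2], evaluated at [n + 1], gives [(s - 1) (n+2)^-s <=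
       (n+1)^-(s-1) - (n+2)^-(s-1)]. *)
    assert (H := Rpower_tangent (s - 1) (INR (S (S n))) (INR (S n))
                   ltac:(lra) (INR_S_pos _) (INR_S_pos _)).
    replace (INR (S n) - INR (S (S n))) with (-1) in H
      by (rewrite (S_INR (S n)); ring).
    assert (E : Rpower (INR (S (S n))) (- s)
                = Rpower (INR (S (S n))) (- (s - 1)) / INR (S (S n))).
    { replace (- s) with (- (s - 1) + - (1)) by ring.
      rewrite Rpower_plus, (Rpower_Ropp _ 1), Rpower_1 by apply INR_S_pos.
      reflexivity. }
    rewrite E. generalize (INR_S_pos (S n)); intro.
    unfold Rdiv in *. lra.
Qed.

Lemma zeta_ex_series (s : R) :
  1 < s -> ex_series (fun n => Rpower (INR (S n)) (- s)).
Proof.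
  intros Hs.
  destruct (ex_finite_lim_seq_incr
    (sum_n (fun n => Rpower (INR (S n)) (- s))) (s / (s - 1))) as [l Hl].
  - intro n. rewrite sum_Sn. generalize (Rpower_pos (INR (S (S n))) (- s)).
    unfold plus; simpl; lra.
  - intro n. rewrite sum_n_Reals.
    generalize (zeta_partial_sum_le s n Hs) (Rpower_pos (INR (S n)) (- (s - 1))).
    intros. apply Rmult_le_reg_l with (s - 1); [lra |].
    replace ((s - 1) * (s / (s - 1))) with s by (field; lra). lra.
  - exists l. exact Hl.
Qed.

Lemma zeta_le (s : R) : 1 < s -> zeta s <= s / (s - 1).
Proof.
  intros Hs.
  assert (H := Series_correct _ (zeta_ex_series s Hs)).
  apply (is_lim_seq_le (sum_n (fun n => Rpower (INR (S n)) (- s)))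
           (fun _ => s / (s - 1)) (zeta s) (s / (s - 1))).
  - intro n. rewrite sum_n_Reals.
    generalize (zeta_partial_sum_le s n Hs) (Rpower_pos (INR (S n)) (- (s - 1))).
    intros. apply Rmult_le_reg_l with (s - 1); [lra |].
    replace ((s - 1) * (s / (s - 1))) with s by (field; lra). lra.
  - exact H.
  - apply is_lim_seq_const.
Qed.

Lemma zeta_ge_partial_sum (s : R) (n : nat) :
  1 < s -> sum_f_R0 (fun k => Rpower (INR (S k)) (- s)) n <= zeta s.
Proof.
  intros Hs. rewrite <- sum_n_Reals.
  apply (is_lim_seq_incr_compare (sum_n (fun k => Rpower (INR (S k)) (- s)))).
  - exact (Series_correct _ (zeta_ex_series s Hs)).
  - intro k. rewrite sum_Sn. generalize (Rpower_pos (INR (S (S k))) (- s)).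
    unfold plus; simpl; lra.
Qed.

Lemma zeta_ge_1 (s : R) : 1 < s -> 1 <= zeta s.
Proof.
  intros Hs. generalize (zeta_ge_partial_sum s 0 Hs). simpl. now rewrite Rpower_1_l.
Qed.

Lemma Rpower_le_exponent (x s t : R) : 1 <= x -> s <= t -> Rpower x s <= Rpower x t.
Proof.
  intros Hx [Hst | ->]; [| lra]. destruct Hx as [Hx | <-].
  - now apply Rle_Rpower; lra.
  - rewrite !Rpower_1_l. lra.
Qed.

Lemma zeta_decreasing (s t : R) : 1 < s -> s <= t -> zeta t <= zeta s.
Proof.
  intros Hs Hst. apply Series_le; [| now apply zeta_ex_series].
  intro n. split; [left; apply Rpower_pos |].
  apply Rpower_le_exponent; [apply INR_S_ge_1 | lra].
Qed.

(* The constant comes from [ln n <= n^d / d]. *)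
Lemma zeta_lipschitz (d s t : R) :
  0 < d -> 1 + 2 * d <= s -> s <= t ->
  zeta s - zeta t <= (t - s) * (zeta (1 + d) / d).
Proof.
  intros Hd Hs Hst. unfold zeta.
  rewrite <- Series_minus by (apply zeta_ex_series; lra).
  replace ((t - s) * (Series (fun n => Rpower (INR (S n)) (- (1 + d))) / d))
    with (((t - s) / d) * Series (fun n => Rpower (INR (S n)) (- (1 + d))))
    by (field; lra).
  rewrite <- Series_scal_l.
  apply Series_le_minor.
  2:{ apply ex_series_minus_R; apply zeta_ex_series; lra. }
  2:{ apply ex_series_scal_R, zeta_ex_series; lra. }
  intro n. set (x := INR (S n)).
  assert (Hx : 1 <= x) by apply INR_S_ge_1.
  assert (Hln : d * ln x <= Rpower x d).
  { unfold Rpower. generalize (exp_ineq1_le (d * ln x)). lra. }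
  assert (Et : Rpower x (- t) = Rpower x (- s) * Rpower x (- (t - s)))
    by (rewrite <- Rpower_plus; f_equal; ring).
  assert (Hts : 1 - (t - s) * ln x <= Rpower x (- (t - s))).
  { unfold Rpower. generalize (exp_ineq1_le (- (t - s) * ln x)). lra. }
  (* The margin [1 + 2 d <= s] pays for the factor [x^d] that replaces the logarithm and still
     leaves the summable exponent [1 + d]. *)
  assert (Hs1 : Rpower x (- s) * Rpower x d <= Rpower x (- (1 + d))).
  { rewrite <- Rpower_plus. apply Rpower_le_exponent; lra. }
  assert (Hpos := Rpower_pos x (- s)).
  apply Rle_trans with (Rpower x (- s) * ((t - s) * ln x)).
  { rewrite Et. nra. }
  apply Rle_trans with ((t - s) / d * (Rpower x (- s) * (d * ln x))).
  { right. field. lra. }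
  apply Rmult_le_compat_l; [apply Rle_mult_inv_pos; lra |].
  apply Rle_trans with (2 := Hs1). apply Rmult_le_compat_l; lra.
Qed.

Lemma zeta_continuous (s : R) : 1 < s -> continuity_pt zeta s.
Proof.
  intros Hs.
  (* With [s = 1 + 4 d], every [t] within [2 d] of [s] exceeds [1 + 2 d], so one Lipschitz constant
     [L] serves on both sides of [s]. *)
  set (d := (s - 1) / 4).
  assert (Hd : 0 < d) by (unfold d; lra).
  set (L := zeta (1 + d) / d).
  assert (HL : 0 < L).
  { apply Rdiv_lt_0_compat; [| assumption]. generalize (zeta_ge_1 (1 + d)); lra. }
  intros eps Heps. exists (Rmin (2 * d) (eps / (2 * L))). split.
  { apply Rmin_glb_lt; [lra | apply Rdiv_lt_0_compat; lra]. }
  intros t [_ Ht]. simpl in *. unfold R_dist in *.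
  assert (H1 := Rlt_le_trans _ _ _ Ht (Rmin_l _ _)).
  assert (H2 := Rlt_le_trans _ _ _ Ht (Rmin_r _ _)).
  apply Rabs_lt_between in H1.
  assert (Heq : L * (eps / (2 * L)) = eps / 2) by (field; lra).
  assert (H3 : L * Rabs (t - s) < eps) by nra.
  assert (s = 1 + 4 * d) by (unfold d; field).
  destruct (Rle_dec s t) as [Hle | Hgt].
  - generalize (zeta_lipschitz d s t Hd ltac:(lra) Hle)
      (zeta_decreasing s t Hs Hle). fold L. intros.
    rewrite Rabs_right in H3 by lra. apply Rabs_lt_between. lra.
  - generalize (zeta_lipschitz d t s Hd ltac:(lra) ltac:(lra))
      (zeta_decreasing t s ltac:(lra) ltac:(lra)). fold L. intros.
    rewrite Rabs_left in H3 by lra. apply Rabs_lt_between. lra.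
Qed.

(** * The unique root of [zeta s = 2^s] *)

Lemma Rpower_2_continuous (s : R) : continuity_pt (Rpower 2) s.
Proof.
  unfold Rpower. apply derivable_continuous_pt.
  exists (ln 2 * exp (s * ln 2)). apply is_derive_Reals. auto_derive; [easy | ring].
Qed.

(* The first eight terms suffice:
   [8^(-1/16) (1 + 1/2 + ... + 1/8) > 2^(17/16)], as [2^(1/4) < 13/10]. *)
Lemma zeta_above_Rpower_2 : Rpower 2 (17/16) < zeta (17/16).
Proof.
  apply Rlt_le_trans with (2 := zeta_ge_partial_sum (17/16) 7 ltac:(lra)).
  assert (Hterm : forall k, (k <= 7)%nat ->
    / INR (S k) * Rpower 8 (- (1/16)) <= Rpower (INR (S k)) (- (17/16))).
  { intros k Hk. replace (- (17/16)) with (- (1) + - (1/16)) by lra.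
    rewrite Rpower_plus, (Rpower_Ropp _ 1), Rpower_1 by apply INR_S_pos.
    apply Rmult_le_compat_l; [left; apply Rinv_0_lt_compat, INR_S_pos |].
    rewrite !Rpower_Ropp. apply Rinv_le_contravar; [apply Rpower_pos |].
    apply Rle_Rpower_l; [lra |]. split; [apply INR_S_pos |].
    replace 8 with (INR 8) by (simpl; ring). apply le_INR. lia. }
  apply Rlt_le_trans with
    (sum_f_R0 (fun k => / INR (S k) * Rpower 8 (- (1/16))) 7).
  2:{ apply sum_Rle. exact Hterm. }
  rewrite <- scal_sum.
  replace (Rpower 8 (- (1/16))) with (Rpower 2 (- (3/16))).
  2:{ replace 8 with (Rpower 2 3).
      - rewrite Rpower_mult. f_equal; lra.
      - replace 3 with (INR 3) by (simpl; ring). rewrite Rpower_pow by lra. simpl; ring. }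
  (* Multiplication by [2^(3/16) = 8^(1/16)] turns the goal into
     [2^(5/4) < 1 + 1/2 + ... + 1/8 = 761/280], and [2 * 13/10] is already smaller than the right
     side. *)
  apply Rmult_lt_reg_l with (Rpower 2 (3/16)); [apply Rpower_pos |].
  rewrite <- Rmult_assoc, <- !Rpower_plus.
  replace (3/16 + - (3/16)) with 0 by ring.
  replace (3/16 + 17/16) with (1/4 + 1) by field.
  rewrite Rpower_plus, Rpower_O, Rpower_1 by lra.
  assert (H4 : Rpower 2 (1/4) ^ 4 = 2).
  { rewrite <- Rpower_pow by apply Rpower_pos. rewrite Rpower_mult.
    replace (1/4 * INR 4) with 1 by (simpl; field). apply Rpower_1; lra. }
  assert (Hr : Rpower 2 (1/4) < 13/10).
  { apply Rnot_le_lt. intro H.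
    generalize (pow_incr (13/10) (Rpower 2 (1/4)) 4 ltac:(lra)).
    rewrite H4. simpl. lra. }
  simpl. lra.
Qed.

(** [zeta] does not increase while [2^s] strictly increases. This gives both uniqueness of the root
    and the hypothesis on [p] in the form used below. *)
Lemma zeta_lt_Rpower_2 (s t : R) :
  1 < s -> s < t -> zeta s = Rpower 2 s -> zeta t < Rpower 2 t.
Proof.
  intros Hs Hst E.
  apply Rle_lt_trans with (1 := zeta_decreasing s t Hs ltac:(lra)).
  rewrite E. apply Rpower_lt; lra.
Qed.

Lemma zeta_Rpower_2_unique_root :
  exists p1, unique (fun s => 1 < s /\ zeta s = Rpower 2 s) p1.
Proof.
  destruct (IVT_interv (fun s => Rpower 2 s - zeta s) (17/16) 2) as [z [Hz E]].
  - intros a Ha. apply continuity_pt_minus.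
    + apply Rpower_2_continuous.
    + apply zeta_continuous; lra.
  - lra.
  - generalize zeta_above_Rpower_2; lra.
  (* At the right end, [zeta 2 <= 2 / (2 - 1) = 2 < 4]. *)
  - generalize (zeta_le 2 ltac:(lra)).
    replace (Rpower 2 2) with (Rpower 2 (1 + 1)) by (f_equal; ring).
    rewrite Rpower_plus, Rpower_1 by lra. lra.
  - exists z. split; [split; lra |].
    intros t [Ht Et]. destruct (Rtotal_order z t) as [H | [H | H]]; [| easy |].
    + generalize (zeta_lt_Rpower_2 z t ltac:(lra) H); lra.
    + generalize (zeta_lt_Rpower_2 t z ltac:(lra) H); lra.
Qed.

(** * The admissible range of [m] *)

(** [m_crit p] and its reciprocal are the two roots of [zeta(p) (1 + m^2) = 2 * 2^p m]; they are
    real and distinct because [zeta p < 2^p], and between them the left side is the smaller. *)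
Lemma m_crit_condition (p m : R) :
  1 < p -> zeta p < Rpower 2 p -> m_crit p < m < 1 / m_crit p ->
  0 < m /\ (1 + m ^ 2) / 2 * (Rpower 2 (- p) * zeta p) < m.
Proof.
  intros Hp Hz [H1 H2]. unfold m_crit in *.
  replace (Rpower 4 p) with (Rpower 2 p ^ 2) in *.
  2:{ replace 4 with (2 * 2) by ring. rewrite <- Rpower_mult_distr by lra. ring. }
  rewrite Rpower_Ropp.
  set (P := Rpower 2 p) in *. set (z := zeta p) in *.
  assert (Hz1 : 1 <= z) by now apply zeta_ge_1.
  set (q := sqrt (P ^ 2 - z ^ 2)) in *.
  assert (Hq : q * q = P ^ 2 - z ^ 2) by (apply sqrt_sqrt; nra).
  assert (Hq0 : 0 <= q) by apply sqrt_pos.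
  assert (HqP : q < P) by nra.
  (* Since [(P - q) (P + q) = z^2], inverting the smaller root gives the larger one. *)
  replace (1 / ((P - q) / z)) with ((P + q) / z) in H2.
  2:{ apply Rmult_eq_reg_r with (z * (P - q)); [| nra].
      replace ((P + q) / z * (z * (P - q))) with (P ^ 2 - q * q) by (field; lra).
      rewrite Hq. field. lra. }
  apply Rlt_div_l in H1; [| lra]. apply Rlt_div_r in H2; [| lra].
  assert (Hm : 0 < m) by nra.
  split; [assumption |].
  apply Rmult_lt_reg_l with (2 * P); [lra |].
  replace (2 * P * ((1 + m ^ 2) / 2 * (/ P * z))) with ((1 + m ^ 2) * z) by (field; lra).
  (* In terms of [m * z] the goal reads [(m z - P)^2 < q^2], which is [P - q < m z < P + q]. *)
  apply Rmult_lt_reg_r with z; [lra |]. nra.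
Qed.

(** * Finite sums over integer indices and periodic sequences *)

(** The range 1 to [n] matches the outer sum of [energy]; integer arguments allow shifts in both
    directions. *)
Fixpoint zsum (f : Z -> R) (n : nat) : R :=
  match n with
  | O => 0
  | S n' => zsum f n' + f (Z.of_nat (S n'))
  end.

Lemma sum_n_m_zsum (f : Z -> R) (n : nat) :
  sum_n_m (fun i => f (Z.of_nat i)) 1 n = zsum f n.
Proof.
  induction n as [|n IH].
  - now rewrite sum_n_m_zero by lia.
  - rewrite sum_n_Sm by lia. simpl zsum. rewrite <- IH. reflexivity.
Qed.

Lemma zsum_ext (f g : Z -> R) (n : nat) :
  (forall i, (1 <= i <= Z.of_nat n)%Z -> f i = g i) -> zsum f n = zsum g n.
Proof.
  induction n as [|n IH]; intros H; [easy |].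
  cbn [zsum]. rewrite IH, H; [easy | lia | intros; apply H; lia].
Qed.

Lemma zsum_le (f g : Z -> R) (n : nat) :
  (forall i, (1 <= i <= Z.of_nat n)%Z -> f i <= g i) -> zsum f n <= zsum g n.
Proof.
  induction n as [|n IH]; intros H; [apply Rle_refl |].
  cbn [zsum]. apply Rplus_le_compat; [apply IH; intros |]; apply H; lia.
Qed.

Lemma zsum_plus (f g : Z -> R) (n : nat) :
  zsum (fun i => f i + g i) n = zsum f n + zsum g n.
Proof. induction n as [|n IH]; cbn [zsum]; [ring | rewrite IH; ring]. Qed.

Lemma zsum_scal (c : R) (f : Z -> R) (n : nat) :
  zsum (fun i => c * f i) n = c * zsum f n.
Proof. induction n as [|n IH]; cbn [zsum]; [ring | rewrite IH; ring]. Qed.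

Lemma zsum_const (c : R) (n : nat) : zsum (fun _ => c) n = INR n * c.
Proof.
  induction n as [|n IH]; [simpl; ring |]. cbn [zsum]. rewrite IH, S_INR. ring.
Qed.

Lemma zsum_pos (f : Z -> R) (n : nat) :
  (0 < n)%nat -> (forall i, 0 < f i) -> 0 < zsum f n.
Proof.
  intros Hn Hf. destruct n as [|n]; [lia |]. cbn [zsum].
  assert (H : zsum (fun _ => 0) n <= zsum f n) by (apply zsum_le; intros; now left).
  rewrite zsum_const in H. specialize (Hf (Z.of_nat (S n))). lra.
Qed.

Lemma zsum_telescope (x : Z -> R) (n : Z) (k : nat) :
  zsum (fun i => x (n + i)%Z - x (n + i - 1)%Z) k = x (n + Z.of_nat k)%Z - x n.
Proof.
  induction k as [|k IH].
  - simpl. rewrite Z.add_0_r. ring.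
  - cbn [zsum]. rewrite IH.
    replace (n + Z.of_nat (S k) - 1)%Z with (n + Z.of_nat k)%Z by lia. ring.
Qed.

Lemma zsum_nonneg_eq_0 (f : Z -> R) (n : nat) :
  (forall i, 0 <= f i) -> zsum f n <= 0 ->
  forall i, (1 <= i <= Z.of_nat n)%Z -> f i = 0.
Proof.
  intros Hf. induction n as [|n IH]; intros H i Hi; [lia |].
  cbn [zsum] in H.
  assert (H0 : zsum (fun _ => 0) n <= zsum f n) by (apply zsum_le; intros; apply Hf).
  rewrite zsum_const in H0.
  assert (Hl := Hf (Z.of_nat (S n))).
  destruct (Z.eq_dec i (Z.of_nat (S n))) as [-> | Hne]; [lra |].
  apply IH; [lra | lia].
Qed.

Definition periodic (N : nat) (f : Z -> R) : Prop :=
  forall k, f (k + Z.of_nat N)%Z = f k.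

Lemma periodic_shift (N : nat) (f : Z -> R) (d : Z) :
  periodic N f -> periodic N (fun n => f (n + d)%Z).
Proof. intros H k. rewrite <- (H (k + d)%Z). f_equal. lia. Qed.

Lemma zsum_shift_nat (N : nat) (f : Z -> R) (d : nat) :
  periodic N f -> zsum (fun n => f (n + Z.of_nat d)%Z) N = zsum f N.
Proof.
  intros Hf. induction d as [|d IH].
  - apply zsum_ext. intros. f_equal. lia.
  - rewrite <- IH. set (g := fun n => f (n + Z.of_nat d)%Z).
    (* A unit shift trades the term at 1 for the one at [1 + k]; for [k = N] these agree by
       periodicity. *)
    assert (Hk : forall k, zsum (fun n => g (n + 1)%Z) k
                          = zsum g k + g (1 + Z.of_nat k)%Z - g 1%Z).
    { induction k as [|k IHk]; [simpl; ring |].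
      cbn [zsum]. rewrite IHk.
      replace (1 + Z.of_nat k)%Z with (Z.of_nat (S k)) by lia.
      replace (Z.of_nat (S k) + 1)%Z with (1 + Z.of_nat (S k))%Z by lia. ring. }
    assert (Hg : periodic N g) by now apply periodic_shift.
    rewrite (zsum_ext _ (fun n => g (n + 1)%Z)).
    + rewrite Hk, Hg. ring.
    + intros i _. unfold g. f_equal. lia.
Qed.

Lemma zsum_shift (N : nat) (f : Z -> R) (d : Z) :
  periodic N f -> zsum (fun n => f (n + d)%Z) N = zsum f N.
Proof.
  intros Hf. destruct (Z_le_gt_dec 0 d) as [Hd | Hd].
  - rewrite <- (Z2Nat.id d Hd). now apply zsum_shift_nat.
  - rewrite <- (zsum_shift_nat N (fun n => f (n + d)%Z) (Z.to_nat (- d)))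
      by now apply periodic_shift.
    apply zsum_ext. intros. f_equal. lia.
Qed.

Lemma periodic_representative (N : nat) (f : Z -> R) (k : Z) :
  (0 < N)%nat -> periodic N f ->
  exists i, (1 <= i <= Z.of_nat N)%Z /\ f k = f i.
Proof.
  intros HN Hf.
  assert (Hq : forall (q : nat) i, f (i + Z.of_nat q * Z.of_nat N)%Z = f i).
  { induction q as [|q IH]; intro i; [f_equal; lia |].
    rewrite <- (IH i), <- (Hf (i + Z.of_nat q * Z.of_nat N)%Z). f_equal. nia. }
  assert (HqZ : forall q i, f (i + q * Z.of_nat N)%Z = f i).
  { intros q i. destruct (Z_le_gt_dec 0 q) as [Hd | Hd].
    - rewrite <- (Z2Nat.id q Hd). apply Hq.
    - rewrite <- (Hq (Z.to_nat (- q)) (i + q * Z.of_nat N)%Z), Z2Nat.id by lia.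
      f_equal. ring. }
  (* The period is taken as 1 to [N], hence the offset by one around the remainder. *)
  exists (1 + (k - 1) mod Z.of_nat N)%Z. split.
  - generalize (Z.mod_pos_bound (k - 1) (Z.of_nat N) ltac:(lia)). lia.
  - rewrite <- (HqZ ((k - 1) / Z.of_nat N) (1 + (k - 1) mod Z.of_nat N))%Z. f_equal.
    generalize (Z.div_mod (k - 1) (Z.of_nat N) ltac:(lia)). lia.
Qed.

(** Only finitely many values occur, so their minimum works. Applied to the gaps, this keeps
    particles uniformly separated. *)
Lemma periodic_lower_bound (N : nat) (f : Z -> R) :
  (0 < N)%nat -> periodic N f -> (forall k, 0 < f k) ->
  exists c, 0 < c /\ forall k, c <= f k.
Proof.
  intros HN Hf Hpos.
  assert (Hn : forall n : nat, exists c, 0 < c /\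
             forall i, (1 <= i <= Z.of_nat n)%Z -> c <= f i).
  { induction n as [|n [c [Hc IH]]].
    - exists 1. split; [lra | intros; lia].
    - exists (Rmin c (f (Z.of_nat (S n)))). split; [now apply Rmin_glb_lt |].
      intros i Hi. destruct (Z.eq_dec i (Z.of_nat (S n))) as [-> | Hne].
      + apply Rmin_r.
      + apply Rle_trans with (1 := Rmin_l _ _). apply IH. lia. }
  destruct (Hn N) as [c [Hc H]]. exists c. split; [assumption |].
  intro k. destruct (periodic_representative N f k HN Hf) as [i [Hi ->]]. now apply H.
Qed.

(** * Jensen's inequality for [x^-p] and its equality case *)

(** The tangent inequalities at the mean [t] are summed; their linear parts cancel. *)
Lemma zsum_Rpower_ge (p t : R) (y : Z -> R) (n : nat) :
  0 < p -> 0 < t -> (forall i, 0 < y i) -> zsum y n = INR n * t ->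
  INR n * Rpower t (- p) <= zsum (fun i => Rpower (y i) (- p)) n.
Proof.
  intros Hp Ht Hy E.
  apply Rle_trans with
    (zsum (fun i => (Rpower t (- p) + p * Rpower t (- p))
                    + - (p * Rpower t (- p) / t) * y i) n).
  - rewrite zsum_plus, zsum_const, zsum_scal, E. right. field. lra.
  - apply zsum_le. intros i _.
    apply Rle_trans with (2 := Rpower_tangent p t (y i) Hp Ht (Hy i)).
    right. field. lra.
Qed.

(** The heights [f i] above the tangent at [t] are nonnegative with sum at most 0, so all vanish;
    strict convexity then leaves only [y i = t]. *)
Lemma zsum_Rpower_ge_eq (p t : R) (y : Z -> R) (n : nat) :
  0 < p -> 0 < t -> (forall i, 0 < y i) -> zsum y n = INR n * t ->
  zsum (fun i => Rpower (y i) (- p)) n <= INR n * Rpower t (- p) ->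
  forall i, (1 <= i <= Z.of_nat n)%Z -> y i = t.
Proof.
  intros Hp Ht Hy E Hle.
  set (f := fun i => Rpower (y i) (- p)
    + (-1) * ((Rpower t (- p) + p * Rpower t (- p))
              + - (p * Rpower t (- p) / t) * y i)).
  intros i Hi.
  assert (H0 : f i = 0).
  { apply (zsum_nonneg_eq_0 f n); [| | assumption].
    - intro j. unfold f. generalize (Rpower_tangent p t (y j) Hp Ht (Hy j)).
      intro H. apply Rle_trans with
        (Rpower (y j) (- p)
          - (Rpower t (- p) - p * Rpower t (- p) / t * (y j - t))); [lra |].
      right. field. lra.
    - unfold f.
      rewrite zsum_plus, zsum_scal, zsum_plus, zsum_const, zsum_scal, E.
      apply Rle_trans with
        (zsum (fun i => Rpower (y i) (- p)) n - INR n * Rpower t (- p)); [| lra].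
      right. field. lra. }
  destruct (Req_dec (y i) t) as [| Hne]; [assumption | exfalso].
  generalize (Rpower_tangent_strict p t (y i) Hp Ht (Hy i) Hne).
  intro Hs. assert (H1 : f i = Rpower (y i) (- p)
    - (Rpower t (- p) - p * Rpower t (- p) / t * (y i - t)))
    by (unfold f; field; lra).
  lra.
Qed.

(** Jensen read as an upper bound for the power of a sum, as needed for attractive pairs, whose
    distance is a sum of [k] gaps. *)
Lemma Rpower_zsum_le (p : R) (a : Z -> R) (k : nat) :
  0 < p -> (0 < k)%nat -> (forall i, 0 < a i) ->
  Rpower (zsum a k) (- p)
    <= Rpower (INR k) (- p) / INR k * zsum (fun i => Rpower (a i) (- p)) k.
Proof.
  intros Hp Hk Ha.
  assert (Hk' : 0 < INR k) by now apply lt_0_INR.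
  assert (Hs := zsum_pos a k Hk Ha).
  set (t := zsum a k / INR k).
  assert (Ht : 0 < t) by now apply Rdiv_lt_0_compat.
  assert (E : zsum a k = INR k * t) by (unfold t; field; lra).
  assert (H := zsum_Rpower_ge p t a k Hp Ht Ha E).
  rewrite E, Rpower_scale by assumption.
  apply Rle_trans with (Rpower (INR k) (- p) / INR k * (INR k * Rpower t (- p))).
  - right. field. lra.
  - apply Rmult_le_compat_l; [| assumption].
    left. apply Rdiv_lt_0_compat; [apply Rpower_pos | assumption].
Qed.

(** * Gaps, couplings and pair energies *)

Definition gap (x : Z -> R) (i : Z) : R := x i - x (i - 1)%Z.

(** The strength of attraction between site [n] and the sites of its own type; odd sites are of type
    1. *)
Definition weight (m : R) (n : Z) : R := if Z.odd n then 1 else m ^ 2.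

(** Two sites have different types exactly when their index difference is odd, so this one
    coefficient encodes all three potentials. *)
Definition coupling (m : R) (n k : Z) : R :=
  if Z.odd (k - n) then m else - weight m n.

Definition pair_energy (p m : R) (x : Z -> R) (n k : Z) : R :=
  coupling m n k * Rpower (Rabs (x k - x n)) (- p).

Lemma weight_pos (m : R) (n : Z) : 0 <= weight m n.
Proof. unfold weight. destruct Z.odd; [lra | apply pow2_ge_0]. Qed.

Lemma weight_succ (m : R) (n : Z) : weight m n + weight m (n + 1) = 1 + m ^ 2.
Proof.
  unfold weight. rewrite Z.odd_add. destruct (Z.odd n); simpl; ring.
Qed.

Lemma odd_even_shift (n : Z) (N : nat) : Nat.Even N -> Z.odd (n + Z.of_nat N) = Z.odd n.
Proof.
  intros [M ->]. rewrite Z.odd_add.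
  replace (Z.of_nat (2 * M)) with (2 * Z.of_nat M)%Z by lia.
  rewrite Z.odd_mul. now destruct (Z.odd n).
Qed.

Lemma weight_periodic (m : R) (N : nat) : Nat.Even N -> periodic N (weight m).
Proof. intros HN n. unfold weight. now rewrite odd_even_shift. Qed.

Lemma coupling_bound (m : R) (n k : Z) : Rabs (coupling m n k) <= 1 + Rabs m + m ^ 2.
Proof.
  assert (H := pow2_ge_0 m). assert (H' := Rabs_pos m).
  unfold coupling. destruct Z.odd; [lra |].
  rewrite Rabs_Ropp, Rabs_right by apply Rle_ge, weight_pos.
  unfold weight. destruct Z.odd; lra.
Qed.

Lemma pair_energy_sym (p m : R) (x : Z -> R) (n k : Z) :
  pair_energy p m x n k = pair_energy p m x k n.
Proof.
  unfold pair_energy. rewrite Rabs_minus_sym. f_equal. unfold coupling, weight.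
  replace (n - k)%Z with (- (k - n))%Z by lia. rewrite Z.odd_opp, Z.odd_sub.
  now destruct (Z.odd k), (Z.odd n).
Qed.

Lemma interaction_pair_energy (p m : R) (F : potentials) (x : Z -> R) (n k : Z) :
  (forall x : R, x <> 0 -> f12 F x = m * Rpower (Rabs x) (- p)) ->
  (forall x : R, x <> 0 -> f11 F x = - Rpower (Rabs x) (- p)) ->
  (forall x : R, x <> 0 -> f22 F x = - m ^ 2 * Rpower (Rabs x) (- p)) ->
  x k <> x n ->
  interaction F (species_of n) (species_of k) (x k - x n) = pair_energy p m x n k.
Proof.
  intros H12 H11 H22 Hne.
  assert (Hx : x k - x n <> 0) by lra.
  unfold pair_energy, coupling, weight, species_of.
  rewrite Z.odd_sub. destruct (Z.odd n), (Z.odd k); simpl;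
    rewrite ?H12, ?H11, ?H22 by assumption; ring.
Qed.

(** * Distances in periodic configurations *)

Lemma configuration_gap_pos (rho : R) (N : nat) (x : Z -> R) (i : Z) :
  configuration rho N x -> 0 < gap x i.
Proof.
  intros [_ H]. destruct (H (i - 1)%Z) as [Hl _].
  replace (i - 1 + 1)%Z with i in Hl by lia. unfold gap. lra.
Qed.

Lemma configuration_diff_periodic (rho : R) (N : nat) (x : Z -> R) (d : Z) :
  configuration rho N x -> periodic N (fun n => x (n + d)%Z - x n).
Proof.
  intros [_ H] n. destruct (H n) as [_ ->].
  replace (n + Z.of_nat N + d)%Z with (n + d + Z.of_nat N)%Z by lia.
  destruct (H (n + d)%Z) as [_ ->]. ring.
Qed.

Lemma gap_periodic (rho : R) (N : nat) (x : Z -> R) :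
  configuration rho N x -> periodic N (gap x).
Proof.
  intros H k. assert (E := configuration_diff_periodic rho N x (- (1)) H k).
  cbv beta in E. rewrite !Z.add_opp_r in E. unfold gap. lra.
Qed.

Lemma diff_zsum_gap (x : Z -> R) (n : Z) (k : nat) :
  x (n + Z.of_nat k)%Z - x n = zsum (fun i => gap x (n + i)) k.
Proof. symmetry. apply zsum_telescope. Qed.

Lemma configuration_diff_pos (rho : R) (N : nat) (x : Z -> R) (n : Z) (k : nat) :
  configuration rho N x -> (0 < k)%nat -> 0 < x (n + Z.of_nat k)%Z - x n.
Proof.
  intros H Hk. rewrite diff_zsum_gap. apply zsum_pos; [assumption |].
  intro i. now apply configuration_gap_pos with rho N.
Qed.

Lemma configuration_gap_sum (rho : R) (N : nat) (x : Z -> R) :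
  configuration rho N x -> zsum (gap x) N = INR N * / rho.
Proof.
  intros [H0 H]. transitivity (x (0 + Z.of_nat N)%Z - x 0%Z).
  - rewrite diff_zsum_gap. now apply zsum_ext.
  - destruct (H 0%Z) as [_ ->]. ring.
Qed.

(** Passing from [k] to [k + 1] adds a shifted sum of gaps over one period, always [N / rho]. Thus
    the mean distance in each shell is the same for all configurations, which is the constraint in
    Jensen's inequality. *)
Lemma configuration_diff_sum (rho : R) (N : nat) (x : Z -> R) (k : nat) :
  configuration rho N x ->
  zsum (fun n => x (n + Z.of_nat k)%Z - x n) N = INR N * (INR k * / rho).
Proof.
  intros H. induction k as [|k IH].
  - transitivity (zsum (fun _ => 0) N).
    + apply zsum_ext. intros i _. simpl. rewrite Z.add_0_r. ring.
    + rewrite zsum_const. simpl. ring.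
  - transitivity (zsum (fun n => (x (n + Z.of_nat k)%Z - x n)
                                  + gap x (n + Z.of_nat (S k))) N).
    + apply zsum_ext. intros i _. unfold gap.
      replace (i + Z.of_nat (S k) - 1)%Z with (i + Z.of_nat k)%Z by lia. ring.
    + rewrite zsum_plus, IH, zsum_shift, (configuration_gap_sum rho), S_INR.
      * ring.
      * assumption.
      * now apply gap_periodic with rho.
Qed.

Lemma equidistant_configuration (rho : R) (N : nat) :
  0 < rho -> configuration rho N (equidistant rho).
Proof.
  intros Hr. assert (H := Rinv_0_lt_compat _ Hr).
  unfold equidistant. split; [simpl; ring |].
  intro k. rewrite !plus_IZR, INR_IZR_INZ. simpl. split; [lra | ring].
Qed.

Lemma equidistant_diff (rho : R) (n : Z) (k : nat) :
  equidistant rho (n + Z.of_nat k) - equidistant rho n = INR k * / rho.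
Proof. unfold equidistant. rewrite plus_IZR, INR_IZR_INZ. ring. Qed.

Lemma configuration_diff_bound (rho : R) (N : nat) (x : Z -> R) :
  configuration rho N x -> (0 < N)%nat ->
  exists c, 0 < c /\ forall n k, c * INR k <= x (n + Z.of_nat k)%Z - x n.
Proof.
  intros H HN.
  destruct (periodic_lower_bound N (gap x) HN) as [c [Hc Hb]].
  - now apply gap_periodic with rho.
  - intro. now apply configuration_gap_pos with rho N.
  - exists c. split; [assumption |]. intros n k. rewrite diff_zsum_gap, Rmult_comm.
    rewrite <- zsum_const. apply zsum_le. intros; apply Hb.
Qed.

(** * Convergence, and the energy as a series over shells *)

Lemma pair_energy_ex_series (p m rho : R) (N : nat) (x : Z -> R) (n : Z) :
  1 < p -> configuration rho N x -> (0 < N)%nat ->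
  ex_series (fun j => pair_energy p m x n (n + Z.of_nat (S j))) /\
  ex_series (fun j => pair_energy p m x n (n - Z.of_nat (S j))).
Proof.
  intros Hp H HN. destruct (configuration_diff_bound rho N x H HN) as [c [Hc Hb]].
  (* Phrased with the larger and the smaller index so that one bound covers the neighbours on both
     sides. *)
  assert (Hbound : forall n k j,
    Rabs (x k - x n) = x (Z.max n k) - x (Z.min n k) ->
    Z.max n k = (Z.min n k + Z.of_nat (S j))%Z ->
    Rabs (pair_energy p m x n k)
      <= (1 + Rabs m + m ^ 2) * Rpower c (- p) * Rpower (INR (S j)) (- p)).
  { intros a b j E1 E2. unfold pair_energy.
    rewrite Rabs_mult, (Rabs_right (Rpower _ _)) by apply Rle_ge, Rlt_le, Rpower_pos.
    rewrite Rmult_assoc, <- Rpower_scale by (assumption || apply INR_S_pos).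
    apply Rmult_le_compat; [apply Rabs_pos | left; apply Rpower_pos
                           | apply coupling_bound |].
    rewrite !Rpower_Ropp. apply Rinv_le_contravar; [apply Rpower_pos |].
    apply Rle_Rpower_l; [lra |]. split.
    - apply Rmult_lt_0_compat; [assumption | apply INR_S_pos].
    - rewrite E1, E2. apply Hb. }
  split; apply ex_series_dominated with
    (fun j => (1 + Rabs m + m ^ 2) * Rpower c (- p) * Rpower (INR (S j)) (- p));
    try (apply ex_series_scal_R, zeta_ex_series, Hp); intro j; apply Hbound;
    try lia; generalize (configuration_diff_pos rho N x n (S j) H ltac:(lia))
      (configuration_diff_pos rho N x (n - Z.of_nat (S j)) (S j) H ltac:(lia)).
  - rewrite Z.max_r, Z.min_l by lia. intros. now apply Rabs_right, Rgt_ge.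
  - rewrite Z.max_l, Z.min_r by lia.
    replace (n - Z.of_nat (S j) + Z.of_nat (S j))%Z with n by lia. intros.
    rewrite Rabs_minus_sym. now apply Rabs_right, Rgt_ge.
Qed.

Definition zsummable (a : Z -> R) : Prop :=
  ex_series (fun j => a (Z.of_nat j)) /\ ex_series (fun j => a (- Z.of_nat (S j))%Z).

Lemma ZSeries_shift_1 (a : Z -> R) :
  zsummable a ->
  zsummable (fun k => a (k - 1)%Z) /\ ZSeries (fun k => a (k - 1)%Z) = ZSeries a.
Proof.
  intros [Hp Hn].
  assert (Ep : forall j, a (Z.of_nat (S j) - 1)%Z = a (Z.of_nat j))
    by (intro; f_equal; lia).
  assert (En : forall j, a (- Z.of_nat (S j) - 1)%Z = a (- Z.of_nat (S (S j)))%Z)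
    by (intro; f_equal; lia).
  assert (Hp' : ex_series (fun j => a (Z.of_nat j - 1)%Z)).
  { apply (proj2 (ex_series_incr_1 (V := R_NormedModule) _)).
    apply ex_series_ext with (2 := Hp). intro; now rewrite Ep. }
  assert (Hn' : ex_series (fun j => a (- Z.of_nat (S j) - 1)%Z)).
  { apply (proj1 (ex_series_incr_1 (V := R_NormedModule) _)) in Hn.
    apply ex_series_ext with (2 := Hn). intro; now rewrite En. }
  split; [now split |]. unfold ZSeries.
  (* Only [a (-1)] changes sides: it heads the old negative half and the new nonnegative half. *)
  rewrite (Series_incr_1 _ Hp'), (Series_incr_1 _ Hn).
  rewrite (Series_ext _ _ Ep), (Series_ext _ _ En). simpl. ring.
Qed.

Lemma ZSeries_shift (a : Z -> R) (n : nat) :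
  zsummable a ->
  zsummable (fun k => a (k - Z.of_nat n)%Z) /\
  ZSeries (fun k => a (k - Z.of_nat n)%Z) = ZSeries a.
Proof.
  intros H. induction n as [|n [IH1 IH2]].
  - replace (fun k => a (k - Z.of_nat 0)%Z) with a; [easy |].
    apply functional_extensionality. intro; f_equal; lia.
  - replace (fun k => a (k - Z.of_nat (S n))%Z)
      with (fun k => a (k - 1 - Z.of_nat n)%Z).
    + destruct (ZSeries_shift_1 _ IH1) as [H1 H2]. now rewrite H2.
    + apply functional_extensionality. intro; f_equal; lia.
Qed.

Lemma Series_zsum (g : Z -> nat -> R) (N : nat) :
  (forall n, ex_series (g n)) ->
  ex_series (fun j => zsum (fun n => g n j) N) /\
  zsum (fun n => Series (g n)) N = Series (fun j => zsum (fun n => g n j) N).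
Proof.
  intros H. induction N as [|N [IH1 IH2]]; cbn [zsum].
  - split.
    + apply ex_series_ext with (fun j => 0 * g 0%Z j); [intro; apply Rmult_0_l |].
      now apply ex_series_scal_R.
    + rewrite (Series_ext _ (fun j => 0 * g 0%Z j)) by (intro; ring).
      rewrite Series_scal_l. ring.
  - split; [now apply ex_series_plus_R |].
    rewrite Series_plus, IH2 by easy. reflexivity.
Qed.

Definition shell_energy (p m : R) (N : nat) (x : Z -> R) (k : nat) : R :=
  zsum (fun n => pair_energy p m x n (n + Z.of_nat k)) N.

(** Each pair is seen once from its left and once from its right end. Over a period both views
    contribute equally, whence the factor 2. *)
Lemma energy_shells (p m rho : R) (F : potentials) (N : nat) (x : Z -> R) :
  (forall x : R, x <> 0 -> f12 F x = m * Rpower (Rabs x) (- p)) ->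
  (forall x : R, x <> 0 -> f11 F x = - Rpower (Rabs x) (- p)) ->
  (forall x : R, x <> 0 -> f22 F x = - m ^ 2 * Rpower (Rabs x) (- p)) ->
  1 < p -> (0 < N)%nat -> Nat.Even N -> configuration rho N x ->
  ex_series (fun j => shell_energy p m N x (S j)) /\
  energy F N x = 2 / INR N * Series (fun j => shell_energy p m N x (S j)).
Proof.
  intros H12 H11 H22 Hp HN Heven Hx.
  set (P := fun n j => pair_energy p m x n (n + Z.of_nat (S j))).
  set (Q := fun n j => pair_energy p m x n (n - Z.of_nat (S j))).
  assert (Hex : forall n, ex_series (P n) /\ ex_series (Q n)).
  { intro n. now apply pair_energy_ex_series with rho N. }
  (* Distinct sites have distinct positions, so the potentials are never evaluated at 0, where their
     values are unspecified. *)
  assert (Hne : forall n k, k <> n -> x k <> x n).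
  { intros n k Hkn. destruct (Z_lt_ge_dec n k).
    - generalize (configuration_diff_pos rho N x n (Z.to_nat (k - n)) Hx ltac:(lia)).
      replace (n + Z.of_nat (Z.to_nat (k - n)))%Z with k by lia. lra.
    - generalize (configuration_diff_pos rho N x k (Z.to_nat (n - k)) Hx ltac:(lia)).
      replace (k + Z.of_nat (Z.to_nat (n - k)))%Z with n by lia. lra. }
  destruct (Series_zsum P N ltac:(apply Hex)) as [HP1 HP2].
  destruct (Series_zsum Q N ltac:(apply Hex)) as [HQ1 HQ2].
  (* By symmetry [Q n j] is [P] at the site [n - (j + 1)]; a shift along the period removes the
     offset. *)
  assert (HPQ : forall j, zsum (fun n => Q n j) N = zsum (fun n => P n j) N).
  { intro j. rewrite <- (zsum_shift N (fun n => P n j) (- Z.of_nat (S j))).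
    - apply zsum_ext. intros i _. unfold P, Q. rewrite pair_energy_sym.
      f_equal; lia.
    - intro k. unfold P, pair_energy, coupling.
      rewrite (configuration_diff_periodic rho N x (Z.of_nat (S j)) Hx k).
      rewrite (weight_periodic m N Heven k).
      replace (k + Z.of_nat N + Z.of_nat (S j) - (k + Z.of_nat N))%Z
        with (k + Z.of_nat (S j) - k)%Z by lia.
      reflexivity. }
  split; [exact HP1 |].
  unfold energy. cbv zeta.
  rewrite (sum_n_m_zsum (fun n => ZSeries (fun k =>
    if Z.eq_dec k n then 0
    else interaction F (species_of n) (species_of k) (x k - x n)))).
  rewrite (zsum_ext _ (fun n => Series (P n) + Series (Q n))).
  - rewrite zsum_plus, HP2, HQ2, (Series_ext _ _ HPQ).
    change (fun j => shell_energy p m N x (S j)) with (fun j => zsum (fun n => P n j) N).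
    field. apply not_0_INR. lia.
  - intros n Hn.
    (* The inner series recentred at [n], with 0 in place of the self-interaction. *)
    set (b := fun d => if Z.eq_dec d 0 then 0 else pair_energy p m x n (n + d)).
    assert (Eb : forall d, (d <> 0)%Z -> b d = pair_energy p m x n (n + d)).
    { intros d Hd. unfold b. now destruct Z.eq_dec. }
    assert (EP : forall j, b (Z.of_nat (S j)) = P n j) by (intro; apply Eb; lia).
    assert (EQ : forall j, b (- Z.of_nat (S j))%Z = Q n j) by (intro; apply Eb; lia).
    destruct (Hex n) as [HexP HexQ].
    assert (Hb : ex_series (fun j => b (Z.of_nat j))).
    { apply (proj2 (ex_series_incr_1 (V := R_NormedModule) _)).
      apply ex_series_ext with (2 := HexP). intro; now rewrite EP. }
    assert (Hbs : zsummable b).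
    { split; [assumption |].
      apply ex_series_ext with (2 := HexQ). intro; now rewrite EQ. }
    (* Here [1 <= n], so the conversion to [nat] loses nothing. *)
    transitivity (ZSeries (fun k => b (k - Z.of_nat (Z.to_nat n))%Z)).
    + f_equal. apply functional_extensionality. intro k. unfold b.
      destruct (Z.eq_dec k n), (Z.eq_dec (k - Z.of_nat (Z.to_nat n)) 0);
        try lia; [reflexivity |].
      rewrite (interaction_pair_energy p m) by auto. f_equal. lia.
    + destruct (ZSeries_shift b (Z.to_nat n) Hbs) as [_ ->].
      (* Splitting off [b 0 = 0] leaves exactly the right and the left neighbours. *)
      unfold ZSeries. rewrite (Series_incr_1 _ Hb).
      rewrite (Series_ext _ _ EP), (Series_ext _ _ EQ).
      unfold b at 1. simpl. ring.
Qed.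

(** * Bounds for single shells *)

(** The quantity [A] of the overview, against which the first and all even shells are measured. *)
Definition gap_energy (p : R) (N : nat) (x : Z -> R) : R :=
  zsum (fun n => Rpower (gap x n) (- p)) N.

Lemma shell_energy_configuration (p m rho : R) (N : nat) (x : Z -> R) (k : nat) :
  configuration rho N x -> (0 < k)%nat ->
  shell_energy p m N x k =
  zsum (fun n => (if Z.odd (Z.of_nat k) then m else - weight m n)
                 * Rpower (x (n + Z.of_nat k)%Z - x n) (- p)) N.
Proof.
  intros H Hk. apply zsum_ext. intros n _. unfold pair_energy, coupling.
  replace (n + Z.of_nat k - n)%Z with (Z.of_nat k) by lia.
  f_equal. f_equal. apply Rabs_right, Rgt_ge. now apply configuration_diff_pos with rho N.
Qed.

(** All couplings in an odd shell equal [m > 0], so Jensen over the period applies with mean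
    distance [k / rho]. *)
Lemma shell_energy_odd_ge (p m rho : R) (N : nat) (x : Z -> R) (k : nat) :
  0 < p -> 0 < m -> 0 < rho -> configuration rho N x -> Nat.Odd k ->
  shell_energy p m N (equidistant rho) k <= shell_energy p m N x k.
Proof.
  intros Hp Hm Hr H [l ->].
  assert (Hk : 0 < INR (2 * l + 1)) by (apply lt_0_INR; lia).
  assert (Hr' := Rinv_0_lt_compat _ Hr).
  rewrite !(shell_energy_configuration p m rho)
    by (try lia; try easy; now apply equidistant_configuration).
  replace (Z.odd (Z.of_nat (2 * l + 1))) with true.
  2:{ replace (Z.of_nat (2 * l + 1)) with (1 + 2 * Z.of_nat l)%Z by lia.
      now rewrite Z.odd_add_mul_2. }
  rewrite !zsum_scal. apply Rmult_le_compat_l; [lra |].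
  apply Rle_trans with (INR N * Rpower (INR (2 * l + 1) * / rho) (- p)).
  - rewrite <- zsum_const. right. apply zsum_ext. intros n _.
    now rewrite equidistant_diff.
  - apply zsum_Rpower_ge; [assumption | | | now apply configuration_diff_sum].
    + now apply Rmult_lt_0_compat.
    + intro n. apply configuration_diff_pos with rho N; [assumption | lia].
Qed.

Lemma shell_energy_1 (p m rho : R) (N : nat) (x : Z -> R) :
  configuration rho N x -> shell_energy p m N x 1 = m * gap_energy p N x.
Proof.
  intros H. rewrite (shell_energy_configuration p m rho) by (lia || easy).
  simpl. rewrite zsum_scal. f_equal. unfold gap_energy.
  rewrite <- (zsum_shift N (fun n => Rpower (gap x n) (- p)) 1).
  - apply zsum_ext. intros i _. unfold gap. f_equal. f_equal. f_equal. lia.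
  - intro k. now rewrite (gap_periodic rho N x H).
Qed.

(* Each gap is covered alternately by windows starting at odd and at even sites. *)
Lemma weighted_window_sum (m : R) (N l : nat) (h : Z -> R) :
  Nat.Even N -> periodic N h ->
  zsum (fun n => weight m n * zsum (fun i => h (n + i)%Z) (2 * l)) N
    = INR l * ((1 + m ^ 2) * zsum h N).
Proof.
  intros HN Hh. induction l as [|l IH].
  - simpl. rewrite (zsum_ext _ (fun _ => 0)), zsum_const by (intros; ring). ring.
  - replace (2 * S l)%nat with (S (S (2 * l))) by lia. cbn [zsum].
    set (d := Z.of_nat (S (2 * l))).
    replace (Z.of_nat (S (S (2 * l)))) with (1 + d)%Z by lia.
    (* Two gaps are appended to each window. Moving the second by one site makes both refer to the
       same gap, with the weights of [n] and [n - 1], which add up to [1 + m^2]. *)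
    set (g := fun n => weight m (n + -1) * h (n + d)%Z).
    assert (Hg : periodic N g).
    { intro n. unfold g.
      rewrite (periodic_shift N _ (-1) (weight_periodic m N HN) n).
      now rewrite (periodic_shift N _ d Hh n). }
    transitivity (zsum (fun n => weight m n * zsum (fun i => h (n + i)%Z) (2 * l)
                    + (weight m n * h (n + d)%Z + g (n + 1)%Z)) N).
    { apply zsum_ext. intros n _. unfold g.
      replace (n + 1 + -1)%Z with n by lia.
      replace (n + 1 + d)%Z with (n + (1 + d))%Z by lia. ring. }
    rewrite !zsum_plus, IH, (zsum_shift N g 1 Hg), <- zsum_plus.
    rewrite (zsum_ext (fun i => weight m i * h (i + d)%Z + g i)
                      (fun n => (1 + m ^ 2) * h (n + d)%Z)).
    + rewrite zsum_scal, (zsum_shift N h d Hh), S_INR. ring.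
    + intros n _. unfold g. rewrite <- (weight_succ m (n + -1)).
      replace (n + -1 + 1)%Z with n by lia. ring.
Qed.

Lemma odd_double (l : nat) : Z.odd (Z.of_nat (2 * l)) = false.
Proof.
  replace (Z.of_nat (2 * l)) with (2 * Z.of_nat l)%Z by lia. now rewrite Z.odd_mul.
Qed.

(** Attraction needs an upper bound on the powers: Jensen inside each window provides it in terms of
    gaps, and [weighted_window_sum] averages the alternating weights. *)
Lemma shell_energy_even_ge (p m rho : R) (N : nat) (x : Z -> R) (l : nat) :
  0 < p -> Nat.Even N -> configuration rho N x -> (0 < l)%nat ->
  - ((1 + m ^ 2) / 2 * Rpower (INR (2 * l)) (- p)) * gap_energy p N x
    <= shell_energy p m N x (2 * l).
Proof.
  intros Hp HN H Hl.
  assert (Hk : 0 < INR (2 * l)) by (apply lt_0_INR; lia).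
  assert (Hg : periodic N (fun n => Rpower (gap x n) (- p))).
  { intro k. now rewrite (gap_periodic rho N x H). }
  set (c := Rpower (INR (2 * l)) (- p) / INR (2 * l)).
  rewrite (shell_energy_configuration p m rho) by (lia || easy).
  rewrite odd_double.
  apply Rle_trans with (zsum (fun n => - c * (weight m n
      * zsum (fun i => Rpower (gap x (n + i)) (- p)) (2 * l))) N).
  - rewrite zsum_scal.
    rewrite (weighted_window_sum m N l (fun n => Rpower (gap x n) (- p)) HN Hg).
    unfold gap_energy, c. rewrite mult_INR in *. simpl INR in *. right. field. lra.
  - apply zsum_le. intros n _.
    generalize (weight_pos m n). rewrite diff_zsum_gap.
    generalize (Rpower_zsum_le p (fun i => gap x (n + i)) (2 * l) Hp ltac:(lia)).
    intros Hj Hw.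
    specialize (Hj ltac:(intro; now apply configuration_gap_pos with rho N)).
    fold c in Hj. apply (Rmult_le_compat_l _ _ _ Hw) in Hj. lra.
Qed.

Lemma zsum_weight (m : R) (N : nat) :
  Nat.Even N -> zsum (weight m) N = INR N * ((1 + m ^ 2) / 2).
Proof.
  intros HN.
  assert (H : zsum (weight m) N + zsum (fun n => weight m (n + 1)) N
              = INR N * (1 + m ^ 2)).
  { rewrite <- zsum_plus, <- zsum_const. apply zsum_ext. intros. apply weight_succ. }
  rewrite zsum_shift in H by now apply weight_periodic. lra.
Qed.

Lemma gap_energy_equidistant (p rho : R) (N : nat) :
  gap_energy p N (equidistant rho) = INR N * Rpower (/ rho) (- p).
Proof.
  unfold gap_energy. rewrite <- zsum_const. apply zsum_ext. intros n _. f_equal.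
  unfold gap, equidistant. rewrite minus_IZR. ring.
Qed.

(** The equality case of [shell_energy_even_ge]: subtracting the two bounds the change of an even
    shell by the change of the gap energy. *)
Lemma shell_energy_even_equidistant (p m rho : R) (N l : nat) :
  0 < rho -> Nat.Even N -> (0 < l)%nat ->
  shell_energy p m N (equidistant rho) (2 * l) =
  - ((1 + m ^ 2) / 2 * Rpower (INR (2 * l)) (- p)) * gap_energy p N (equidistant rho).
Proof.
  intros Hr HN Hl. assert (Hr' := Rinv_0_lt_compat _ Hr).
  assert (Hk : 0 < INR (2 * l)) by (apply lt_0_INR; lia).
  rewrite (shell_energy_configuration p m rho)
    by (lia || now apply equidistant_configuration).
  rewrite odd_double, gap_energy_equidistant.
  rewrite (zsum_ext _ (fun n => - Rpower (INR (2 * l) * / rho) (- p) * weight m n)).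
  - rewrite zsum_scal, zsum_weight, Rpower_scale by assumption. ring.
  - intros n _. rewrite equidistant_diff. ring.
Qed.

Lemma gap_energy_ge (p rho : R) (N : nat) (x : Z -> R) :
  0 < p -> 0 < rho -> configuration rho N x ->
  gap_energy p N (equidistant rho) <= gap_energy p N x.
Proof.
  intros Hp Hr H. rewrite gap_energy_equidistant.
  apply zsum_Rpower_ge; [assumption | now apply Rinv_0_lt_compat | |].
  - intro. now apply configuration_gap_pos with rho N.
  - now apply configuration_gap_sum.
Qed.

(** The equality case of Jensen makes every gap equal to the mean [/ rho]. *)
Lemma gap_energy_min_unique (p rho : R) (N : nat) (x : Z -> R) :
  0 < p -> 0 < rho -> (0 < N)%nat -> configuration rho N x ->
  gap_energy p N x <= gap_energy p N (equidistant rho) -> x = equidistant rho.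
Proof.
  intros Hp Hr HN H Hle. rewrite gap_energy_equidistant in Hle.
  assert (Hgap : forall k, gap x k = / rho).
  { intro k.
    destruct (periodic_representative N (gap x) k HN (gap_periodic rho N x H))
      as [i [Hi ->]].
    apply (zsum_Rpower_ge_eq p (/ rho) (gap x) N); auto.
    - now apply Rinv_0_lt_compat.
    - intro. now apply configuration_gap_pos with rho N.
    - now apply configuration_gap_sum. }
  apply functional_extensionality. intro k. unfold equidistant.
  (* Equal gaps determine [x] up to translation; [x 0 = 0] fixes the translation, with gaps summed
     from 0 up to [k] or from [k] up to 0. *)
  destruct H as [H0 _].
  destruct (Z_le_gt_dec 0 k) as [Hk | Hk].
  - assert (E := diff_zsum_gap x 0 (Z.to_nat k)).
    rewrite (zsum_ext _ (fun _ => / rho)), zsum_const in E by (intros; apply Hgap).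
    rewrite INR_IZR_INZ, Z2Nat.id, Z.add_0_l in E by lia. lra.
  - assert (E := diff_zsum_gap x k (Z.to_nat (- k))).
    rewrite (zsum_ext _ (fun _ => / rho)), zsum_const in E by (intros; apply Hgap).
    rewrite INR_IZR_INZ, Z2Nat.id, Z.add_opp_diag_r, opp_IZR in E by lia. lra.
Qed.

(** * Summation of the shell bounds *)

(** The factor of the gap energy excess in the lower bound for shell [k]. It is 0 for odd [k] from 3
    on, where the nonnegative excess is simply dropped. *)
Definition shell_coefficient (p m : R) (k : nat) : R :=
  if Nat.even k then - ((1 + m ^ 2) / 2 * Rpower (INR k) (- p))
  else if Nat.eqb k 1 then m else 0.

Lemma shell_energy_comparison (p m rho : R) (N : nat) (x : Z -> R) (k : nat) :
  0 < p -> 0 < m -> 0 < rho -> Nat.Even N -> configuration rho N x -> (0 < k)%nat ->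
  shell_coefficient p m k * (gap_energy p N x - gap_energy p N (equidistant rho))
    <= shell_energy p m N x k - shell_energy p m N (equidistant rho) k.
Proof.
  intros Hp Hm Hr HN H Hk. unfold shell_coefficient.
  destruct (Nat.Even_or_Odd k) as [He | Ho].
  - rewrite (proj2 (Nat.even_spec k) He). destruct He as [l ->].
    rewrite shell_energy_even_equidistant by (lia || assumption).
    generalize (shell_energy_even_ge p m rho N x l Hp HN H ltac:(lia)). lra.
  - replace (Nat.even k) with false.
    2:{ rewrite <- Nat.negb_odd. now rewrite (proj2 (Nat.odd_spec k) Ho). }
    destruct (Nat.eqb_spec k 1) as [-> | Hk1].
    + rewrite !(shell_energy_1 p m rho) by (easy || now apply equidistant_configuration).
      lra.
    + generalize (shell_energy_odd_ge p m rho N x k Hp Hm Hr H Ho). lra.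
Qed.

(** Viewed as a power series at 1, the series splits into even and odd parts, and the odd part
    vanishes. *)
Lemma is_series_even_support (u : nat -> R) (L : R) :
  (forall l, u (2 * l + 1)%nat = 0) ->
  is_series (fun l => u (2 * l)%nat) L -> is_series u L.
Proof.
  intros Hu HL.
  assert (H : is_pseries u 1 (L + 1 * 0)).
  { apply is_pseries_odd_even; apply is_pseries_R.
    - apply is_series_ext with (2 := HL). intro n. now rewrite !pow1, Rmult_1_r.
    - apply is_series_ext with (fun n => 0 * u (2 * n)%nat).
      + intro n. rewrite Hu. now rewrite !Rmult_0_l.
      + generalize (is_series_scal (V := R_NormedModule) 0 _ L HL).
        change (scal 0 L) with (0 * L). now rewrite Rmult_0_l. }
  apply is_pseries_R in H. rewrite Rmult_0_r, Rplus_0_r in H.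
  apply is_series_ext with (2 := H). intro n. now rewrite pow1, Rmult_1_r.
Qed.

Lemma shell_coefficient_sum (p m : R) :
  1 < p ->
  is_series (fun j => shell_coefficient p m (S j))
    (m - (1 + m ^ 2) / 2 * (Rpower 2 (- p) * zeta p)).
Proof.
  intros Hp. apply is_series_decr_1.
  match goal with |- is_series _ ?l =>
    replace l with (- ((1 + m ^ 2) / 2 * Rpower 2 (- p)) * zeta p) end.
  2:{ unfold plus, opp; simpl. unfold shell_coefficient; simpl. ring. }
  (* With [k = 1] removed the series starts at [k = 2], so its even positions [2 l] are the shells
     [k = 2 (l + 1)], which produce [2^-p zeta(p)]. *)
  apply is_series_even_support.
  - intro l. unfold shell_coefficient.
    replace (S (S (2 * l + 1))) with (1 + 2 * (l + 1))%nat by lia.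
    rewrite Nat.even_add_mul_2. destruct (Nat.eqb_spec (1 + 2 * (l + 1)) 1); [lia | easy].
  - assert (E : forall l, - ((1 + m ^ 2) / 2 * Rpower 2 (- p)) * Rpower (INR (S l)) (- p)
                          = shell_coefficient p m (S (S (2 * l)))).
    { intro l. unfold shell_coefficient.
      replace (S (S (2 * l))) with (2 * S l)%nat by lia.
      rewrite Nat.even_mul. simpl orb. cbv iota.
      rewrite mult_INR, Rpower_scale by (apply INR_S_pos || (simpl; lra)).
      simpl (INR 2). replace (1 + 1) with 2 by ring. ring. }
    apply (is_series_ext _ _ _ E).
    apply (is_series_scal (V := R_NormedModule)).
    apply Series_correct, zeta_ex_series, Hp.
Qed.

Lemma energy_gap_ge (p m rho : R) (F : potentials) (N : nat) (x : Z -> R) :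
  (forall x : R, x <> 0 -> f12 F x = m * Rpower (Rabs x) (- p)) ->
  (forall x : R, x <> 0 -> f11 F x = - Rpower (Rabs x) (- p)) ->
  (forall x : R, x <> 0 -> f22 F x = - m ^ 2 * Rpower (Rabs x) (- p)) ->
  1 < p -> 0 < m -> 0 < rho -> (0 < N)%nat -> Nat.Even N -> configuration rho N x ->
  2 / INR N * ((m - (1 + m ^ 2) / 2 * (Rpower 2 (- p) * zeta p))
               * (gap_energy p N x - gap_energy p N (equidistant rho)))
    <= energy F N x - energy F N (equidistant rho).
Proof.
  intros H12 H11 H22 Hp Hm Hr HN Heven H.
  assert (He := equidistant_configuration rho N Hr).
  destruct (energy_shells p m rho F N x) as [Hx ->]; try assumption.
  destruct (energy_shells p m rho F N (equidistant rho)) as [Hex ->]; try assumption.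
  rewrite <- Rmult_minus_distr_l, <- Series_minus by assumption.
  apply Rmult_le_compat_l.
  { left. apply Rdiv_lt_0_compat; [lra | now apply lt_0_INR]. }
  assert (Hc := shell_coefficient_sum p m Hp).
  rewrite <- (is_series_unique _ _ Hc), <- Series_scal_r.
  apply Series_le_minor.
  - intro j. apply shell_energy_comparison; try assumption; [lra | lia].
  - apply ex_series_scal_r. eexists; exact Hc.
  - now apply ex_series_minus_R.
Qed.

Theorem corollary2p3 :
  exists p1 : R,
    unique (fun s : R => 1 < s /\ zeta s = Rpower 2 s) p1 /\
    forall (p m : R) (F : potentials),
      p1 < p ->
      m_crit p < m < 1 / m_crit p ->
      (forall x : R, x <> 0 -> f12 F x = m * Rpower (Rabs x) (- p)) ->
      (forall x : R, x <> 0 -> f11 F x = - Rpower (Rabs x) (- p)) ->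
      (forall x : R, x <> 0 -> f22 F x = - m ^ 2 * Rpower (Rabs x) (- p)) ->
      forall (rho : R) (N : nat),
        0 < rho -> (0 < N)%nat -> Nat.Even N ->
        unique (minimizer (configuration rho N) (energy F N)) (equidistant rho).
Proof.
  destruct zeta_Rpower_2_unique_root as [p1 Hp1]. exists p1. split; [assumption |].
  destruct Hp1 as [[Hp1 Ez] _].
  intros p m F Hp Hm H12 H11 H22 rho N Hr HN Heven.
  destruct (m_crit_condition p m ltac:(lra)
              (zeta_lt_Rpower_2 p1 p Hp1 Hp Ez) Hm) as [Hm0 Hk].
  assert (Hgap := fun x => energy_gap_ge p m rho F N x H12 H11 H22
                    ltac:(lra) Hm0 Hr HN Heven).
  set (kappa := m - (1 + m ^ 2) / 2 * (Rpower 2 (- p) * zeta p)) in *.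
  (* Positivity of [kappa] is exactly the condition on [m] obtained from [m_crit_condition]. *)
  assert (Hkappa : 0 < kappa) by (unfold kappa; lra).
  assert (HN2 : 0 < 2 / INR N) by (apply Rdiv_lt_0_compat; [lra | now apply lt_0_INR]).
  split; [split |].
  - now apply equidistant_configuration.
  - intros y Hy. specialize (Hgap y Hy).
    assert (Hge := gap_energy_ge p rho N y ltac:(lra) Hr Hy).
    assert (0 <= 2 / INR N
                 * (kappa * (gap_energy p N y - gap_energy p N (equidistant rho)))).
    { apply Rmult_le_pos; [lra |]. apply Rmult_le_pos; lra. }
    lra.
  - intros x [Hx Hmin]. specialize (Hgap x Hx).
    specialize (Hmin _ (equidistant_configuration rho N Hr)).
    symmetry. apply (gap_energy_min_unique p rho N x); try assumption; [lra |].
    (* A strictly larger gap energy would force a strictly larger energy, against the minimality of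
       [x]. *)
    apply Rnot_lt_le. intro Hlt.
    assert (0 < 2 / INR N
                * (kappa * (gap_energy p N x - gap_energy p N (equidistant rho)))).
    { apply Rmult_lt_0_compat; [lra |]. apply Rmult_lt_0_compat; lra. }
    lra.
Qed.
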